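(* Let $S\in\mathbb{S}^2_+$, and put $a=\frac{S_{11}+S_{22}}{2}$ and $b=S_{12}$ (so that $a>|b|$). The entropy loss $\rho\mapsto I(S\|\Sigma_\rho)$ of the bivariate correlation model is convex over $(-1,1)$ if and only if $(b,a)$ lies in the region above (the curve included) the central component $\mathcal{C}$ of the zero locus of the discriminant $\Delta_g$, i.e. if and only if there is $a'\le a$ with $(b,a')\in\mathcal{C}$.
   Context: $\mathbb{S}^n_+$ denotes the set of real symmetric positive definite $n\times n$ matrices. For $\Sigma_1,\Sigma_2\in\mathbb{S}^n_+$, $I(\Sigma_1\|\Sigma_2)=\mathrm{trace}(\Sigma_1\Sigma_2^{-1})-\log\det(\Sigma_1\Sigma_2^{-1})-n$; for fixed $S\in\mathbb{S}^n_+$ the entropy loss is $\Sigma\mapsto I(S\|\Sigma)$. The bivariate correlation model consists of the matrices $\Sigma_\rho=\begin{bmatrix}1&\rho\\ \rho&1\end{bmatrix}$ with $\rho\in(-1,1)$. The second derivative of $\rho\mapsto I(S\|\Sigma_\rho)$ is $\frac{2}{(1-\rho^2)^3}g(\rho)$ with $$g(\rho)=2a-1-6b\rho+6a\rho^2-2b\rho^3+\rho^4.$$ The discriminant of $g$ is $$\Delta_g(b,a)=-256\Big(27b^6-27(2a^2+6a-5)b^4+9(3a^4+36a^3-32a^2+8a+1)b^2-(2a-1)(9a^2-2a+1)^2\Big).$$ The central component $\mathcal{C}$ of the zero locus $\{\Delta_g=0\}$ in the cone $\{(b,a)\in\mathbb{R}^2: a>|b|\}$ is the branch passing through $(b,a)=(0,\frac12)$;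 it is the set of points $(b,a)$ of the cone for which $g$ has a multiple root $\rho\in(-1,1)$. *)

(* Defs.v *)
From HB Require Import structures.
From mathcomp Require Import all_boot all_order all_algebra.
From mathcomp Require Import all_classical all_reals all_analysis.

Set Implicit Arguments.
Unset Strict Implicit.
Unset Printing Implicit Defensive.

Import Order.TTheory GRing.Theory Num.Theory.
Import numFieldNormedType.Exports.

Local Open Scope classical_set_scope.
Local Open Scope ring_scope.

Definition posdefmx (R : realType) (n : nat) (A : 'M[R]_n) : Prop :=
  A \is symmetricmx /\
  forall x : 'cV[R]_n, x != 0 -> 0 < (x^T *m A *m x) 0 0.

(* The information divergence I(S1 || S2); it is meaningful for positive
   definite arguments. The entropy loss of S is [info_div S]. *)
Definition info_div (R : realType) (n : nat) (S1 S2 : 'M[R]_n) : R :=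
  \tr (S1 *m invmx S2) - ln (\det (S1 *m invmx S2)) - n%:R.

Definition corr_mx (R : realType) (r : R) : 'M[R]_2 :=
  \matrix_(i, j) (if i == j then 1 else r).

(* Numerator of the second derivative of r |-> info_div S (corr_mx r): the
   latter equals 2 / (1 - r ^+ 2) ^+ 3 * (corr_poly b a).[r] when S is symmetric
   with half-trace a and off-diagonal entry b. *)
Definition corr_poly (R : realType) (b a : R) : {poly R} :=
  (2 * a - 1)%:P - (6 * b) *: 'X + (6 * a) *: 'X^2 - (2 * b) *: 'X^3 + 'X^4.

Definition corr_disc (R : realType) (b a : R) : R :=
  - 256 * (27 * b ^+ 6
           - 27 * (2 * a ^+ 2 + 6 * a - 5) * b ^+ 4
           + 9 * (3 * a ^+ 4 + 36 * a ^+ 3 - 32 * a ^+ 2 + 8 * a + 1) * b ^+ 2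
           - (2 * a - 1) * (9 * a ^+ 2 - 2 * a + 1) ^+ 2).

Definition corr_cone (R : realType) : set (R * R) :=
  [set p | `|p.1| < p.2].

Definition disc_locus (R : realType) : set (R * R) :=
  [set p | corr_cone p /\ corr_disc p.1 p.2 = 0].

(* Points are pairs (b, a). The branch of the locus through (0, 1/2) is singled
   out by the location of the multiple root. It is not a connected component of
   [disc_locus]: at b ^+ 2 = 24, a = 5 the polynomial has one double root inside
   ]-1, 1[ and one outside, and there the branch crosses another one. *)
Definition central_component (R : realType) : set (R * R) :=
  [set p | disc_locus p /\
    exists2 r : R, -1 < r < 1 & (1 < mup r (corr_poly p.1 p.2))%N].

(* Main.v *)
Require Import Defs.
From HB Require Import structures.
From mathcomp Require Import all_boot all_order all_algebra.
From mathcomp Require Import all_classical all_reals all_analysis.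
From mathcomp Require Import ring lra.

(** The second derivative of the loss at [r] is [2 / (1 - r^2)^3] times
    [g = corr_poly b a], so that convexity on ]-1, 1[ means [0 <= g] there
    ([convex_second_derivative], [is_derive2_bivariate_loss]). It remains to
    compare this sign condition with the central component
    ([corr_poly_ge0_iff]), which is pure algebra.

    The polynomial [g] is affine in [(b, a)]. For [s] in ]-1, 1[ the equations
    [g s = 0] and [g' s = 0] are therefore two linear equations in [(b, a)],
    with determinant [-12 (1 - s^2)^2 <> 0]: exactly one pair,
    [(contact_b s, contact_a s)], makes [s] a multiple root. The central
    component is thus a rational curve parametrized by its multiple root
    ([central_componentE]); membership in the cone and vanishing of the
    discriminant hold along the whole curve. Dividing [g] by [(r - s)^2] at
    such a pair gives
      [3 (1 - s^2)^2 g r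
         = (r - s)^2 (3 (1 - s^2)^2 r^2 - 16 s^3 r + (3 + s^2)^2)],
    where the last factor is positive for [r] in [-1, 1]: there
    [16 s^3 r <= 16 s^2], and
    [(3 + s^2)^2 - 16 s^2 = (1 - s) (3 - s) (1 + s) (3 + s)] is positive. So on the
    curve [g] is nonnegative on ]-1, 1[ and vanishes at [s].

    Since [g] increases with [a] (the coefficient of [a] is [2 + 6 r^2]), it
    stays nonnegative above the curve. Conversely [contact_b] takes every real
    value ([contact_b_surj]), so the curve has a point [(b, contact_a s)] on
    each vertical line, and [0 <= g s] forces [contact_a s <= a]. *)

Set Implicit Arguments.
Unset Strict Implicit.
Unset Printing Implicit Defensive.

Import Order.TTheory GRing.Theory Num.Theory.
Import numFieldNormedType.Exports.

Local Open Scope classical_set_scope.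
Local Open Scope ring_scope.

(** * Convexity and the second derivative *)

Section Convexity.
Context {R : realType}.
Implicit Types (f : R -> R) (u v x y d c : R).

Lemma convex_lmodE (t : {i01 R}) (x y : R^o) :
  conv t (x : convex_lmodType R^o) y = t%:num * x + (1 - t%:num) * y :> R.
Proof. by []. Qed.

Lemma eq_convex_function f (g : R -> R) u v :
  (forall x, u < x < v -> f x = g x) ->
  convex_function (E := R^o) `]u, v[ f -> convex_function (E := R^o) `]u, v[ g.
Proof.
move=> fg cf t x y xI yI; have := cf t x y xI yI.
move: xI yI; rewrite !inE/= !in_itv/= => xI yI.
rewrite -!fg// convex_lmodE.
have [t0 t1] : 0 <= t%:num :> R /\ t%:num <= 1 :> R by split.
move: (t%:num) t0 t1 => w w0 w1.
have [->|w00] := eqVneq w 0; first lra.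
have {}w0 : 0 < w by rewrite lt0r w00.
by apply/andP; split; nra.
Qed.

Lemma is_derive_le f x d c : is_derive x 1 f d ->
  (\forall h \near 0^'+, (f (x + h) - f x) / h <= c) -> d <= c.
Proof.
move=> [df <-] fc; move/cvg_ex: df => [l fl].
rewrite /derive (cvg_lim _ fl)//.
apply: (cvgr_to_le (cvg_dnbhs_at_right fl)).
apply: filterS fc => h /=.
by rewrite [h%:A]mulr1 [x + h]addrC [X in _ -> X <= c]mulrC.
Qed.

(** Along the segment from [x] to [y], parametrized by [h] in [0, 1], convexity
    bounds every difference quotient at [h = 0] by [f y - f x]. *)
Lemma convex_above_tangent f u v x y d :
  convex_function (E := R^o) `]u, v[ f ->
  u < x < v -> u < y < v -> is_derive x 1 f d -> f x + d * (y - x) <= f y.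
Proof.
move=> cf xI yI dfx.
have dphi : is_derive (0 : R) 1 (fun t => f (x + t * (y - x))) (d * (y - x)).
  have dl : is_derive (0 : R) 1 (fun t : R => x + t * (y - x)) (y - x).
    by apply: is_derive_eq; rewrite scaler0 !add0r mul1r [_%:A]mulr1.
  have := @is_derive1_comp R f (fun t : R => x + t * (y - x)) 0 d (y - x).
  by rewrite mul0r addr0; exact.
rewrite -lerBrDl; apply: (is_derive_le dphi).
near=> h.
have h0 : 0 < h by near: h; exact: nbhs_right_gt.
have h1 : h < 1 by near: h; exact: nbhs_right_lt.
rewrite add0r mul0r addr0 ler_pdivrMr//.
have := cf (Itv01 (ltW h0) (ltW h1)) y x.
rewrite !inE/= !in_itv/= => /(_ yI xI).
rewrite convex_lmodE convRE/= /unstable.onem.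
have -> : h * y + (1 - h) * x = x + h * (y - x) by ring.
lra.
Unshelve. all: by end_near.
Qed.

(** For the direct implication, adding the two tangent inequalities at [x] and
    [x + h] shows that [f1] is nondecreasing, so its difference quotients are
    nonnegative. The converse is [second_derivative_convex] on each segment. *)
Lemma convex_second_derivative f (f1 f2 : R -> R) u v :
  (forall x, u < x < v -> is_derive x 1 f (f1 x)) ->
  (forall x, u < x < v -> is_derive x 1 f1 (f2 x)) ->
  convex_function (E := R^o) `]u, v[ f <-> forall x, u < x < v -> 0 <= f2 x.
Proof.
move=> df df1; split=> [cf x xI|f2ge0 t x y].
  have := df1 _ xI => /is_deriveN df1x; rewrite -oppr_le0.
  apply: (is_derive_le df1x); near=> h.
  have h0 : 0 < h by near: h; exact: nbhs_right_gt.
  have h1 : h < v - x by near: h; apply: nbhs_right_lt; lra.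
  have xhI : u < x + h < v by lra.
  have := convex_above_tangent cf xI xhI (df _ xI).
  have := convex_above_tangent cf xhI xI (df _ xhI).
  rewrite pmulr_lle0 ?invr_gt0//= -(pmulr_lle0 _ h0).
  rewrite -[(- f1) (x + h)]/(- f1 (x + h)) -[(- f1) x]/(- f1 x); lra.
wlog xy : t x y / x <= y.
  move=> H; have [|/ltW yx] := leP x y; first exact: H.
  by move=> xI yI; rewrite convC [leRHS]convC; exact: H.
rewrite !inE/= !in_itv/= => xI yI.
have D1 z : u < z < v -> 'D_1 f z = f1 z by move=> /df[].
have cvf z : u < z < v -> {for z, continuous f}.
  by move=> /df[dfz _]; exact/differentiable_continuous/derivable1_diffP.
have nearI z : u < z < v -> \forall w \near z, u < w < v.
  move=> zI; have : z \in `]u, v[ by rewrite in_itv.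
  by move=> /near_in_itvoo; apply: filterS => w; rewrite in_itv.
have D2 z : u < z < v -> is_derive z 1 ('D_1 f) (f2 z).
  move=> zI; apply: near_eq_is_derive (df1 _ zI).
  by apply: filterS (nearI _ zI) => w /D1.
have xyI z : z \in `]x, y[ -> u < z < v by rewrite in_itv/=; lra.
apply: (second_derivative_convex _ _ _ _ _ _ xy).
- by move=> z zI; have [|_ ->] := D2 z; [lra|apply: f2ge0; lra].
- exact/cvg_at_left_filter/cvf.
- exact/cvg_at_right_filter/cvf.
- by move=> z /xyI/df[].
- by move=> z /xyI/D2[].
Unshelve. all: by end_near.
Qed.

End Convexity.

(** * Curve of the pairs (b, a) for which the polynomial has a double root *)

Lemma double_rootE (F : fieldType) (p : {poly F}) (x : F) : p != 0 ->
  (1 < mup x p)%N = root p x && root p^`() x.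
Proof.
move=> p0; rewrite mup_geq//; apply/idP/andP => [/dvdpP[q ->]|[]].
  by rewrite !rootE !poly.derivE/= !hornerE/= subrr; split; apply/eqP; ring.
move=> /factor_theorem[q ->]; rewrite [root (_^`()) _]rootE !poly.derivE.
rewrite !hornerE subrr mulr0 add0r -rootE => /factor_theorem[q' ->].
by rewrite -mulrA dvdp_mulIr.
Qed.

Section ContactCurve.
Context {R : realType}.
Implicit Types a b r s : R.

Lemma onemsqr_gt0 s : -1 < s < 1 -> 0 < 1 - s ^+ 2.
Proof. nra. Qed.

Lemma onemsqr_neq0 s : -1 < s < 1 -> 1 - s ^+ 2 != 0.
Proof. by move=> /onemsqr_gt0/lt0r_neq0. Qed.

Lemma horner_corr_poly b a r : (corr_poly b a).[r] =
  2 * a - 1 - 6 * b * r + 6 * a * r ^+ 2 - 2 * b * r ^+ 3 + r ^+ 4.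
Proof. by rewrite /corr_poly !hornerE. Qed.

Lemma horner_deriv_corr_poly b a r : (corr_poly b a)^`().[r] =
  - 6 * b + 12 * a * r - 6 * b * r ^+ 2 + 4 * r ^+ 3.
Proof. by rewrite /corr_poly !poly.derivE !hornerE/=; ring. Qed.

Lemma corr_poly_neq0 b a : corr_poly b a != 0.
Proof.
apply/eqP => /(congr1 (fun p : {poly R} => p`_4)).
rewrite /corr_poly !coefE/= !mulr0 subrr addr0 subr0 add0r => /eqP.
by rewrite oner_eq0.
Qed.

(** The solution [(b, a)] of the linear system saying that [s] is a root of
    [corr_poly b a] and of its derivative. *)
Definition contact_b s : R :=
  (3 * s + 2 * s ^+ 3 + 3 * s ^+ 5) / (3 * (1 - s ^+ 2) ^+ 2).
Definition contact_a s : R :=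
  (3 + 3 * s ^+ 2 + 9 * s ^+ 4 + s ^+ 6) / (6 * (1 - s ^+ 2) ^+ 2).

Lemma double_root_contact b a s : -1 < s < 1 ->
  (1 < mup s (corr_poly b a))%N <-> b = contact_b s /\ a = contact_a s.
Proof.
move=> /onemsqr_neq0 s1; rewrite double_rootE ?corr_poly_neq0// !rootE.
rewrite horner_corr_poly horner_deriv_corr_poly /contact_b /contact_a.
set g := 2 * a - 1 - _ + _ - _ + _.
set g' := - 6 * b + _ - _ + _.
split=> [/andP[/eqP g0 /eqP g'0]|[bE aE]].
  (* Cramer's rule, written for the differences to the solution. *)
  split; apply/eqP; rewrite -subr_eq0; apply/eqP.
  - transitivity ((12 * s * g - (2 + 6 * s ^+ 2) * g') /
        (12 * (1 - s ^+ 2) ^+ 2)); first by rewrite /g /g'; field.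
    by rewrite g0 g'0; ring.
  - transitivity (((6 + 6 * s ^+ 2) * g - (6 * s + 2 * s ^+ 3) * g') /
        (12 * (1 - s ^+ 2) ^+ 2)); first by rewrite /g /g'; field.
    by rewrite g0 g'0; ring.
by rewrite /g /g' bE aE; apply/andP; split; apply/eqP; field.
Qed.

Lemma horner_corr_poly_contact s r : -1 < s < 1 ->
  (corr_poly (contact_b s) (contact_a s)).[r] =
  (r - s) ^+ 2 *
    (3 * (1 - s ^+ 2) ^+ 2 * r ^+ 2 - 16 * s ^+ 3 * r + (3 + s ^+ 2) ^+ 2)
  / (3 * (1 - s ^+ 2) ^+ 2).
Proof.
move=> /onemsqr_neq0 s1.
by rewrite horner_corr_poly /contact_b /contact_a; field.
Qed.

Lemma contact_cofactor_gt0 s r : -1 < s < 1 -> -1 <= r <= 1 ->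
  0 < 3 * (1 - s ^+ 2) ^+ 2 * r ^+ 2 - 16 * s ^+ 3 * r + (3 + s ^+ 2) ^+ 2.
Proof.
move=> s1 r1.
have s2_lt : 16 * s ^+ 2 < (3 + s ^+ 2) ^+ 2.
  rewrite -subr_gt0.
  have -> : (3 + s ^+ 2) ^+ 2 - 16 * s ^+ 2 =
      (1 - s) * (3 - s) * ((1 + s) * (3 + s)) by ring.
  by rewrite !mulr_gt0//; lra.
have s3r_le : s ^+ 3 * r <= s ^+ 2.
  by rewrite exprS mulrAC ler_piMl ?sqr_ge0//; nra.
have := sqr_ge0 ((1 - s ^+ 2) * r); lra.
Qed.

Lemma corr_poly_contact_gt0 s r : -1 < s < 1 -> -1 <= r <= 1 -> r != s ->
  0 < (corr_poly (contact_b s) (contact_a s)).[r].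
Proof.
move=> s1 r1 rs; rewrite horner_corr_poly_contact// divr_gt0//.
  by rewrite mulr_gt0 ?contact_cofactor_gt0// exprn_even_gt0//= subr_eq0.
by rewrite mulr_gt0// exprn_even_gt0//= onemsqr_neq0.
Qed.

(** The values of [corr_poly b a] at [1] and [-1] are [8 (a - b)] and
    [8 (a + b)], so the cone condition is positivity at both end points. *)
Lemma corr_cone_contact s : -1 < s < 1 -> corr_cone (contact_b s, contact_a s).
Proof.
move=> s1; rewrite /corr_cone/= ltr_norml.
have := @corr_poly_contact_gt0 s 1 s1; rewrite horner_corr_poly.
have := @corr_poly_contact_gt0 s (-1) s1; rewrite horner_corr_poly.
move=> /(_ ltac:(lra) ltac:(lra)) gN1 /(_ ltac:(lra) ltac:(lra)) g1.
by apply/andP; split; lra.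
Qed.

Lemma corr_disc_contact s : -1 < s < 1 ->
  corr_disc (contact_b s) (contact_a s) = 0.
Proof.
move=> /onemsqr_neq0 s1.
by rewrite /corr_disc /contact_b /contact_a; field.
Qed.

(** The intermediate value theorem for the numerator of [contact_b s - b]; the
    values [-8] and [8] at the end points do not depend on [b] because the
    denominator of [contact_b] vanishes there. *)
Lemma contact_b_surj b : exists2 s, -1 < s < 1 & contact_b s = b.
Proof.
pose p : {poly R} :=
  3 *: 'X + 2 *: 'X^3 + 3 *: 'X^5 - (3 * b) *: (1 - 'X^2) ^+ 2.
have pE x : p.[x] =
    3 * x + 2 * x ^+ 3 + 3 * x ^+ 5 - 3 * b * (1 - x ^+ 2) ^+ 2.
  by rewrite /p !hornerE.
have pN1 : p.[-1] = - 8 by rewrite pE; ring.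
have p1 : p.[1] = 8 by rewrite pE; ring.
have [||s /andP[sgeN1 sle1] /eqP ps] := @poly_ivt R p (-1) 1.
- lra.
- rewrite pN1 p1; lra.
have s1 : -1 < s < 1.
  rewrite !lt_neqAle sgeN1 sle1 !andbT; apply/andP; split; apply/eqP => sE.
    by move: ps; rewrite -sE pN1; lra.
  by move: ps; rewrite sE p1; lra.
exists s => //; rewrite /contact_b; have s2 := onemsqr_neq0 s1.
have -> : 3 * s + 2 * s ^+ 3 + 3 * s ^+ 5 = 3 * b * (1 - s ^+ 2) ^+ 2.
  by move: ps; rewrite pE; lra.
by field.
Qed.

Lemma central_componentE b a : central_component (b, a) <->
  exists2 s, -1 < s < 1 & b = contact_b s /\ a = contact_a s.
Proof.
split=> [[_ [s s1 ds]]|[s s1 [-> ->]]].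
  by exists s => //; exact/(double_root_contact _ _ s1).
split; last by exists s => //; exact/(double_root_contact _ _ s1).
by split; [exact: corr_cone_contact|exact: corr_disc_contact].
Qed.

Lemma corr_poly_ge0_iff b a :
  (forall r, -1 < r < 1 -> 0 <= (corr_poly b a).[r]) <->
  exists2 a', a' <= a & central_component (b, a').
Proof.
have polyD a' r : (corr_poly b a).[r] =
    (corr_poly b a').[r] + (a - a') * (2 + 6 * r ^+ 2).
  by rewrite !horner_corr_poly; ring.
have coef_gt0 r : 0 < 2 + 6 * r ^+ 2 by have := sqr_ge0 r; lra.
split=> [g0|[a' a'a /central_componentE[s s1 [bE aE]]] r r1].
  have [s s1 bE] := contact_b_surj b; exists (contact_a s); last first.
    by apply/central_componentE; exists s.
  have := g0 _ s1; rewrite (polyD (contact_a s)) -bE horner_corr_poly_contact//.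
  by rewrite subrr expr0n !mul0r add0r pmulr_lge0// subr_ge0.
rewrite (polyD a') addr_ge0//; last by rewrite mulr_ge0 ?subr_ge0// ltW.
rewrite bE aE; have [->|rs] := eqVneq r s.
  by rewrite horner_corr_poly_contact// subrr expr0n !mul0r.
by apply/ltW/corr_poly_contact_gt0 => //; lra.
Qed.

End ContactCurve.

(** * Entropy loss of the bivariate correlation model *)

Lemma det_mx2 (R : comNzRingType) (A : 'M[R]_2) :
  \det A = A 0 0 * A 1 1 - A 0 1 * A 1 0.
Proof.
rewrite (expand_det_row _ 0) !big_ord_recl big_ord0 addr0 /cofactor.
rewrite !det_mx11 !mxE/= /bump/= !expr0 expr1 mul1r mulN1r mulrN.
by congr (_ * A _ _ - A _ _ * A _ _); apply/val_inj.
Qed.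

Lemma symmetricmxE (F : fieldType) n (A : 'M[F]_n) i j :
  A \is symmetricmx -> A j i = A i j.
Proof. by move=> /is_hermitianmxP {1}->; rewrite expr0 scale1r !mxE. Qed.

Section EntropyLoss.
Context {R : realType}.
Implicit Types (S : 'M[R]_2) (a b c r : R).

Lemma posdefmx2_det_gt0 S : posdefmx S -> 0 < \det S.
Proof.
move=> [/(symmetricmxE (0 : 'I_2) 1) S10 qS].
have quad (p q : R) : let x := \col_i (if i == 0 then p else q) in
    (x^T *m S *m x) 0 0 =
    S 0 0 * p ^+ 2 + 2 * S 0 1 * p * q + S 1 1 * q ^+ 2.
  rewrite /= mxE !big_ord_recl big_ord0 !mxE !big_ord_recl !big_ord0 !mxE/=.
  by rewrite (_ : lift ord0 ord0 = 1) ?S10/=; [ring|exact/val_inj].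
have nz (p q : R) (i : 'I_2) : (if i == 0 then p else q) != 0 ->
    \col_(i < 2) (if i == 0 then p else q) != 0.
  by apply: contra => /eqP/matrixP/(_ i 0); rewrite !mxE => ->.
have := qS _ (nz 1 0 0 (oner_neq0 _)); rewrite quad => S00.
have S00_gt0 : 0 < S 0 0 by lra.
(* At the vector (- S01, S00) the quadratic form equals S00 * det S. *)
have := qS _ (nz (- S 0 1) (S 0 0) 1 (lt0r_neq0 S00_gt0)); rewrite quad.
rewrite det_mx2 S10; set q := (X in 0 < X).
have -> : q = S 0 0 * (S 0 0 * S 1 1 - S 0 1 * S 0 1) by rewrite /q; ring.
by rewrite pmulr_rgt0.
Qed.

Lemma invmx_corr_mx r : -1 < r < 1 ->
  invmx (corr_mx r) = (1 - r ^+ 2)^-1 *: corr_mx (- r).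
Proof.
move=> /onemsqr_neq0 r1.
have E : corr_mx r *m ((1 - r ^+ 2)^-1 *: corr_mx (- r)) = 1%:M.
  apply/matrixP => i j; rewrite !mxE !big_ord_recl big_ord0 !mxE.
  by case: i => -[|[|i]] ilt//; case: j => -[|[|j]] jlt//=; field.
have [u _] := mulmx1_unit E.
by rewrite -[RHS](mulKmx u) E mulmx1.
Qed.

(** Keeping the part that depends only on [S] in a constant [c] leaves an
    explicit function of one real variable to differentiate. *)
Definition bivariate_loss b a c r : R :=
  2 * (a - b * r) / (1 - r ^+ 2) + ln (1 - r ^+ 2) + c.

Definition bivariate_loss1 b a r : R :=
  2 * (r ^+ 3 - b * r ^+ 2 + (2 * a - 1) * r - b) / (1 - r ^+ 2) ^+ 2.

Lemma info_div_corr_mx S r : posdefmx S -> -1 < r < 1 ->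
  info_div S (corr_mx r) =
  bivariate_loss (S 0 1) ((S 0 0 + S 1 1) / 2) (- ln (\det S) - 2) r.
Proof.
move=> hS r1; have r0 := onemsqr_gt0 r1; have d0 := posdefmx2_det_gt0 hS.
have S10 : S 1 0 = S 0 1 by case: hS => /symmetricmxE ->.
rewrite /info_div /bivariate_loss det_mulmx det_inv.
have -> : \det (corr_mx r) = 1 - r ^+ 2 by rewrite det_mx2 !mxE/=; ring.
rewrite ln_div ?posrE// invmx_corr_mx// -scalemxAr mxtraceZ.
have -> : \tr (S *m corr_mx (- r)) = S 0 0 + S 1 1 - 2 * S 0 1 * r.
  rewrite /mxtrace !big_ord_recl big_ord0 !mxE !big_ord_recl !big_ord0 !mxE/=.
  by rewrite (_ : lift ord0 ord0 = 1) ?S10; [ring|exact/val_inj].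
by field; exact: lt0r_neq0.
Qed.

Lemma is_derive_bivariate_loss b a c r : -1 < r < 1 ->
  is_derive r 1 (bivariate_loss b a c) (bivariate_loss1 b a r).
Proof.
move=> r11; have r0 := onemsqr_gt0 r11; have r1 := onemsqr_neq0 r11.
have dq : is_derive r 1 (fun r : R => 1 - r ^+ 2) (- (2 * r)).
  by apply: is_derive_eq; rewrite /GRing.scale/=; ring.
have dv := is_deriveV (f := fun r : R => 1 - r ^+ 2) r1 dq.
have dl := is_derive1_comp (g := fun r : R => 1 - r ^+ 2) (is_derive1_ln r0) dq.
have dn : is_derive r 1 (fun r : R => 2 * (a - b * r)) (- (2 * b)).
  by apply: is_derive_eq; rewrite /GRing.scale/=; ring.
have := is_deriveD (is_deriveD (is_deriveM dn dv) dl) (is_derive_cst c r 1).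
move=> /is_derive_eq; apply.
by rewrite /bivariate_loss1 /GRing.scale/=; field.
Qed.

Lemma is_derive2_bivariate_loss b a r : -1 < r < 1 ->
  is_derive r 1 (bivariate_loss1 b a)
    (2 / (1 - r ^+ 2) ^+ 3 * (corr_poly b a).[r]).
Proof.
move=> /onemsqr_neq0 r1.
have dq : is_derive r 1 (fun r : R => (1 - r ^+ 2) ^+ 2)
    (- (4 * r * (1 - r ^+ 2))).
  by apply: is_derive_eq; rewrite /GRing.scale/=; ring.
have q0 : (1 - r ^+ 2) ^+ 2 != 0 by rewrite expf_neq0.
have dv := is_deriveV (f := fun r : R => (1 - r ^+ 2) ^+ 2) q0 dq.
have dn : is_derive r 1
    (fun r : R => 2 * (r ^+ 3 - b * r ^+ 2 + (2 * a - 1) * r - b))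
    (2 * (3 * r ^+ 2 - 2 * b * r + (2 * a - 1))).
  by apply: is_derive_eq; rewrite /GRing.scale/=; ring.
have := is_deriveM dn dv; move=> /is_derive_eq; apply.
by rewrite horner_corr_poly /GRing.scale/=; field.
Qed.

End EntropyLoss.

Theorem theorem3p2 (R : realType) (S : 'M[R]_2) (hS : posdefmx S) :
  let a : R := (S 0 0 + S 1 1) / 2 in
  let b : R := S 0 1 in
  convex_function (E := R^o) `]-1, 1[ (fun r : R => info_div S (corr_mx r)) <->
  exists2 a' : R, a' <= a & central_component (b, a').
Proof.
move=> a b; rewrite -corr_poly_ge0_iff.
have lossE r := @info_div_corr_mx _ S r hS.
have convexE := convex_second_derivative
  (is_derive_bivariate_loss b a (- ln (\det S) - 2))
  (is_derive2_bivariate_loss b a).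
have coef_gt0 (r : R) : -1 < r < 1 -> 0 < 2 / (1 - r ^+ 2) ^+ 3.
  by move=> /onemsqr_gt0 r1; rewrite divr_gt0// exprn_gt0.
split=> [cf r r1|g0].
  rewrite -(pmulr_rge0 _ (coef_gt0 _ r1)).
  apply: (convexE.1 _ r r1); apply: eq_convex_function cf => x.
  exact: lossE.
apply: (@eq_convex_function _ (bivariate_loss b a (- ln (\det S) - 2))).
  by move=> r /lossE.
by apply: convexE.2 => r r1; rewrite pmulr_rge0 ?coef_gt0//; exact: g0.
Qed.
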